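(* Let $\alpha\in(0,1)$, and let $Z$ be a real random variable whose probability density function $f_Z(z;\theta)$ is parameterized by $\theta\in\mathbb{R}^k$. Assume: (1) for all $\theta$, $Z$ is a continuous random variable and is bounded in $[-b,b]$ (with $b$ not depending on $\theta$); (2) for all $\theta$ and $1\le j\le k$, the derivatives $\frac{\partial}{\partial\theta_j}\nu_\alpha(Z;\theta)$ and $\frac{\partial}{\partial\theta_j}\Phi_\alpha(Z;\theta)$ exist and are bounded; (3) for all $\theta$, $z$ and $1\le j\le k$, the ratio $\frac{\partial f_Z(z;\theta)}{\partial\theta_j}\big/ f_Z(z;\theta)$ exists and is bounded. Then, for all $\theta$ and $1\le j\le k$, $$\frac{\partial}{\partial\theta_j}\Phi_\alpha(Z;\theta)=\mathbb{E}^{\theta}\left[\left.\frac{\partial\log f_Z(Z;\theta)}{\partial\theta_j}\,\bigl(Z-\nu_\alpha(Z;\theta)\bigr)\,\right|\,Z\le\nu_\alpha(Z;\theta)\right].$$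
   Context: A random variable $Z$ is called continuous if its cumulative distribution function $F_Z(z)=\Pr(Z\le z)$ is everywhere continuous. For a confidence level $\alpha\in(0,1)$, the $\alpha$-Value-at-Risk (the $\alpha$-quantile) of $Z$ is $\nu_\alpha(Z)=F_Z^{-1}(\alpha)=\inf\{z: F_Z(z)\ge\alpha\}$, and the $\alpha$-Conditional-Value-at-Risk (CVaR) of $Z$ is $\Phi_\alpha(Z)=\mathbb{E}[Z\mid Z\le\nu_\alpha(Z)]$. When the distribution of $Z$ depends on a parameter $\theta$, $\nu_\alpha(Z;\theta)$ and $\Phi_\alpha(Z;\theta)$ denote these quantities when the parameter is $\theta$, and $\mathbb{E}^\theta$ denotes expectation under the distribution with parameter $\theta$. *)

(* Defs.v *)
From HB Require Import structures.
From mathcomp Require Import all_boot all_order all_algebra.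
From mathcomp Require Import all_classical all_reals all_analysis.

Set Implicit Arguments.
Unset Strict Implicit.
Unset Printing Implicit Defensive.
Import Order.TTheory GRing.Theory Num.Theory.
Import numFieldNormedType.Exports.
Local Open Scope classical_set_scope.
Local Open Scope ring_scope.

(* [f] is a probability density function of the real random variable [X]. *)
Definition is_density (d : measure_display) (T : measurableType d)
    (R : realType) (P : probability T R) (X : {RV P >-> R}) (f : R -> R) : Prop :=
  [/\ measurable_fun [set: R] f,
      forall z, 0 <= f z
    & forall A : set R, measurable A ->
        distribution P X A = (\int[lebesgue_measure]_(z in A) (f z)%:E)%E].

(* Elementary conditional expectation E[Y | A] given an event A with
   0 < P A.  It is extended-real valued; a finite value entails, for
   measurable [Y], that [Y] is integrable on A. *)
Definition cond_expectation (d : measure_display) (T : measurableType d)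
    (R : realType) (P : probability T R) (A : set T) (Y : T -> R) : \bar R :=
  ((\int[P]_(w in A) (Y w)%:E) / P A)%E.

(* nu_alpha(X) *)
Definition value_at_risk (d : measure_display) (T : measurableType d)
    (R : realType) (P : probability T R) (X : {RV P >-> R}) (alpha : R) : R :=
  inf [set z : R | (alpha%:E <= cdf X z)%E].

(* The lower-tail CVaR Phi_alpha(X) = E[X | X <= nu_alpha(X)]. *)
Definition cvar (d : measure_display) (T : measurableType d)
    (R : realType) (P : probability T R) (X : {RV P >-> R}) (alpha : R) : R :=
  fine (cond_expectation P [set w | X w <= value_at_risk X alpha] X).

(* The j-th vector of the standard basis: ['D_(basis_vec j) g theta] is the
   partial derivative of [g] at [theta] with respect to theta_j. *)
Definition basis_vec (R : realType) (k : nat) (j : 'I_k) : 'rV[R]_k :=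
  delta_mx 0 j.
Arguments basis_vec {R k} j.

(* Main.v *)
(* The CVaR has the variational form (Rockafellar-Uryasev)
     Phi(theta) = max_c (c + E^theta[min(Z - c, 0)] / alpha),
   attained at c = nu(theta).  Freeze c = nu(theta_0) and restrict theta to the
   line through theta_0 in direction j: Phi minus the frozen objective is
   nonnegative and vanishes at theta_0, so its derivative there is 0.  Hence
   dPhi/dtheta_j is the derivative of E^theta[min(Z - c, 0)] / alpha in which c
   is constant, and no boundary term at the quantile appears.  The bound
   |df/dtheta_j| <= M f gives by Gronwall f(z, t) <= exp(M |t - s|) f(z, s),
   which provides the dominating function for differentiating under the integral
   sign and shows that the support of the density is constant along the line. *)
Require Import Defs.
From HB Require Import structures.
From mathcomp Require Import all_boot all_order all_algebra.
From mathcomp Require Import all_classical all_reals all_analysis.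
From mathcomp Require Import measurable_realfun ring lra.

Set Implicit Arguments.
Unset Strict Implicit.
Unset Printing Implicit Defensive.
Import Order.TTheory GRing.Theory Num.Theory.
Import numFieldNormedType.Exports.
Local Open Scope classical_set_scope.
Local Open Scope ring_scope.

(** * Calculus along a line of parameters *)

(** The two sides are the quotients hidden in [derivable] and [derive], for [g] in direction [v] and
    for its restriction to the line in direction 1, so both notions transfer by rewriting. *)
Lemma quotient_line (R : realType) (V : normedModType R) (g : V -> R)
    (a v : V) (t : R) :
  (fun h : R => h^-1 *: (g (h *: v + (a + t *: v)) - g (a + t *: v))) =
  (fun h : R => h^-1 *: (g (a + (h *: 1 + t) *: v) - g (a + t *: v))).
Proof.
by apply/funext => h; rewrite addrCA -scalerDl [h *: 1]mulr1.
Qed.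

Lemma derivable_line (R : realType) (V : normedModType R) (g : V -> R)
    (a v : V) (t : R) :
  derivable g (a + t *: v) v -> derivable (fun s : R => g (a + s *: v)) t 1.
Proof. by rewrite /derivable quotient_line. Qed.

Lemma derive_line (R : realType) (V : normedModType R) (g : V -> R)
    (a v : V) (t : R) :
  'D_1 (fun s : R => g (a + s *: v)) t = 'D_v g (a + t *: v).
Proof. by rewrite /derive quotient_line. Qed.

(** With the integrating factor [expR (- M * u)], the product with [g] has nonpositive
    derivative. *)
Lemma gronwall_forward (R : realType) (g : R -> R) (M : R) :
  (forall t : R, derivable g t 1) -> (forall t, `|'D_1 g t| <= M * g t) ->
  forall s t, s <= t -> g t <= expR (M * (t - s)) * g s.
Proof.
move=> dg gM s t st.
have dE (x : R) : is_derive x 1 (fun u : R => expR (- M * u) * g u)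
    (expR (- M * x) * ('D_1 g x - M * g x)).
  have dx : is_derive x 1 g ('D_1 g x) by exact: DeriveDef.
  apply: is_derive_eq; rewrite /GRing.scale/=; ring.
have : expR (- M * t) * g t <= expR (- M * s) * g s.
  apply: (@ler0_derive1_le_cc R (fun u : R => expR (- M * u) * g u) s t) => //.
  - move=> x _; rewrite derive1E derive_val.
    rewrite mulr_ge0_le0 ?expR_ge0// subr_le0.
    exact: le_trans (ler_norm _) (gM x).
  - by apply: derivable_within_continuous => x _; exact: ex_derive.
  - by rewrite in_itv/= lexx st.
  - by rewrite in_itv/= lexx st.
rewrite -(ler_pM2l (expR_gt0 (M * t))) !mulrA -!expRD.
rewrite mulNr subrr expR0 mul1r => /le_trans; apply.
by rewrite mulNr mulrBr.
Qed.

(** The hypotheses are invariant under the reflection [u -> - u], which turns the case [t < s] into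
    the forward one. *)
Lemma gronwall (R : realType) (g : R -> R) (M : R) :
  (forall t : R, derivable g t 1) -> (forall t, `|'D_1 g t| <= M * g t) ->
  forall s t, g t <= expR (M * `|t - s|) * g s.
Proof.
move=> dg gM s t; have [st|/ltW ts] := lerP s t.
  exact: gronwall_forward.
pose gN (u : R) := g (- u).
have dgN (u : R) : is_derive u 1 gN (- 'D_1 g (- u)).
  have dx : is_derive (- u) 1 g ('D_1 g (- u)) by exact: DeriveDef.
  apply: is_derive_eq; rewrite /GRing.scale/=; ring.
have : gN (- t) <= expR (M * (- t - - s)) * gN (- s).
  apply: gronwall_forward; last by rewrite lerN2.
    by move=> u; exact: ex_derive.
  by move=> u; rewrite derive_val normrN; exact: gM.
by rewrite /gN !opprK (addrC (- t)).
Qed.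

(** A zero of a nonnegative function is a minimum. This serves both the zeros of the density and the
    contact point in the variational inequality. *)
Lemma derive_zero_at_zero (R : realType) (g : R -> R) (c : R) :
  (forall t : R, derivable g t 1) -> (forall t, 0 <= g t) -> g c = 0 ->
  'D_1 g c = 0.
Proof.
move=> dg g0 gc.
suff H : is_derive c 1 g 0 by exact: derive_val.
apply: (@derive1_at_min _ _ (c - 1) (c + 1)) => //.
- lra.
- by rewrite in_itv/=; apply/andP; split; lra.
- by move=> t _; rewrite gc.
Qed.

(** * Expectations as integrals against the density *)

(** The law of [X] is dominated by Lebesgue measure, and [f] is a version of its Radon-Nikodym
    derivative. *)
Lemma ge0_integral_density (d : measure_display) (T : measurableType d)
    (R : realType) (P : probability T R) (X : {RV P >-> R}) (f : R -> R)
    (phi : R -> R) :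
  is_density X f -> measurable_fun [set: R] phi -> (forall x, 0 <= phi x) ->
  (\int[P]_w (phi (X w))%:E = \int[lebesgue_measure]_z (phi z * f z)%:E)%E.
Proof.
move=> [mf f0 fE] mphi phi0.
(* [X] is repackaged because [R] and [measurableTypeR R], on which
   [lebesgue_measure] lives, have the same sigma-algebra but different displays. *)
have mX : measurable_fun [set: T] (X : T -> measurableTypeR R).
  exact: (measurable_funPT X).
pose X' : {mfun T >-> measurableTypeR R} := HB.pack (X : T -> measurableTypeR R)
  (isMeasurableFun.Build _ _ _ _ _ mX).
pose nu : {finite_measure set (measurableTypeR R) -> \bar R} :=
  distribution P X'.
pose mu : {sigma_finite_measure set (measurableTypeR R) -> \bar R} :=
  @lebesgue_measure R.
have numu : nu `<< mu.
  apply/null_content_dominatesP => A mA A0.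
  rewrite /nu/= [LHS]fE//; apply: null_set_integral => //.
  exact/measurable_EFinP/measurable_funTS.
transitivity (\int[nu]_z (phi z)%:E)%E.
  by rewrite ge0_integral_distribution//; exact/measurable_EFinP.
rewrite -(Radon_Nikodym_SigmaFinite.change_of_variables numu)//; last first.
  exact/measurable_EFinP.
have intRN := Radon_Nikodym_SigmaFinite.f_integrable numu.
apply: ae_eq_integral => //.
- apply: emeasurable_funM; first exact/measurable_EFinP.
  exact: measurable_int intRN.
- exact/measurable_EFinP/measurable_funM.
(* Equal integrals over every measurable set force equality almost everywhere. *)
have : ae_eq mu setT (Radon_Nikodym_SigmaFinite.f nu mu) (EFin \o f).
  apply: integral_ae_eq => //; first exact/measurable_EFinP.
  move=> E _ mE; rewrite -Radon_Nikodym_SigmaFinite.f_integral//.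
  exact: fE.
by apply: filterS => z /(_ I) fz _; rewrite fz.
Qed.

(** Positive and negative parts are treated separately; since [f] is nonnegative, it factors out of
    each maximum with 0. *)
Lemma integral_density (d : measure_display) (T : measurableType d)
    (R : realType) (P : probability T R) (X : {RV P >-> R}) (f : R -> R)
    (phi : R -> R) :
  is_density X f -> measurable_fun [set: R] phi ->
  (\int[P]_w (phi (X w))%:E = \int[lebesgue_measure]_z (phi z * f z)%:E)%E.
Proof.
move=> fX mphi; have [_ f0 _] := fX.
rewrite integralE [RHS]integralE; congr (_ - _)%E.
- transitivity (\int[P]_w (Num.max (phi (X w)) 0)%:E)%E.
    by apply: eq_integral => w _; rewrite funeposE EFin_max.
  rewrite (@ge0_integral_density _ _ _ _ _ f (fun z => Num.max (phi z) 0))//.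
  + apply: eq_integral => z _; rewrite funeposE -EFin_max.
    by rewrite maxr_pMl// mul0r.
  + exact: measurable_maxr.
  + by move=> x; rewrite le_max lexx orbT.
- transitivity (\int[P]_w (Num.max (- phi (X w)) 0)%:E)%E.
    by apply: eq_integral => w _; rewrite funenegE EFin_max.
  rewrite (@ge0_integral_density _ _ _ _ _ f (fun z => Num.max (- phi z) 0))//.
  + apply: eq_integral => z _; rewrite funenegE -EFinN -EFin_max.
    by rewrite maxr_pMl// mul0r mulNr.
  + apply: measurable_maxr => //; exact: measurableT_comp.
  + by move=> x; rewrite le_max lexx orbT.
Qed.

(** * The quantile of a continuous law *)

(** The limits of the cdf at both infinities make the infimum a genuine one; continuity then
    excludes both strict inequalities. *)
Lemma cdf_value_at_risk (d : measure_display) (T : measurableType d)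
    (R : realType) (P : probability T R) (X : {RV P >-> R}) (alpha : R) :
  0 < alpha < 1 -> continuous (cdf X) ->
  cdf X (value_at_risk X alpha) = alpha%:E.
Proof.
move=> /andP[a0 a1] cX; pose S := [set z | (alpha%:E <= cdf X z)%E].
have [z0 Sz0] : S !=set0.
  have : \forall r \near +oo, (alpha%:E < cdf X r)%E.
    apply: (@cvg_cdfy1 _ _ _ P X [set y | (alpha%:E < y)%E]).
    by apply: open_ereal_gt'; rewrite lte_fin.
  by move=> /filter_ex[r /ltW]; exists r.
have [m Sm] : exists m, lbound S m.
  have : \forall r \near -oo, (cdf X r < alpha%:E)%E.
    apply: (@cvg_cdfNy0 _ _ _ P X [set y | (y < alpha%:E)%E]).
    by apply: open_ereal_lt'; rewrite lte_fin.
  move=> [m [_ mP]]; exists (m - 1) => z Sz; rewrite leNgt; apply/negP => zm.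
  have /mP : z < m by lra.
  by rewrite ltNge => /negP; apply; exact: Sz.
have infS : has_inf S by split; [exists z0 | exists m].
rewrite /value_at_risk -/S; set nu := inf S.
apply/eqP; rewrite eq_le; apply/andP; split; rewrite leNgt; apply/negP => H.
(* A value above [alpha] would persist slightly to the left of [nu], below the infimum. *)
- have : \forall r \near nu, (alpha%:E < cdf X r)%E.
    by apply: (cX nu [set y | (alpha%:E < y)%E]); exact: open_ereal_gt'.
  move=> /nbhs_ballP[e /= e0 eP].
  have : (alpha%:E < cdf X (nu - e / 2))%E.
    apply: eP => /=; rewrite /ball/= opprB addrC subrK gtr0_norm; lra.
  move=> /ltW SH; have := ge_inf (proj2 infS) SH.
  by rewrite -/nu; lra.
(* A value below [alpha] would persist slightly to the right, where [S] has a point. *)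
- have : \forall r \near nu, (cdf X r < alpha%:E)%E.
    by apply: (cX nu [set y | (y < alpha%:E)%E]); exact: open_ereal_lt'.
  move=> /nbhs_ballP[e /= e0 eP].
  have [z Sz] := inf_adherent e0 infS; rewrite -/nu => ze.
  have : (cdf X z < alpha%:E)%E.
    apply: eP => /=; rewrite /ball/= distrC ger0_norm ?subr_ge0.
      by rewrite ltrBlDl.
    exact: (ge_inf (proj2 infS) Sz).
  by rewrite ltNge => /negP; apply.
Qed.

(** * Bounded integrands and clipping *)

Lemma integrable_bounded (d : measure_display) (T : measurableType d)
    (R : realType) (P : probability T R) (D : set T) (g : T -> R) (M : R) :
  measurable D -> measurable_fun [set: T] g -> (forall w, `|g w| <= M) ->
  P.-integrable D (EFin \o g).
Proof.
move=> mD mg gM; apply: (@integrableS _ _ _ P setT) => //.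
apply: measurable_bounded_integrable => //.
  exact: le_lt_trans (probability_le1 _ _) (ltry _).
exists M; split; rewrite ?num_real// => x Mx y _ /=.
exact: le_trans (gM y) (ltW Mx).
Qed.

(* Clipping changes a [-b, b]-valued variable only on a null set and makes every
   integrand below bounded. *)
Definition clip (R : realType) (b z : R) : R := Num.max (- b) (Num.min z b).

Lemma clip_id (R : realType) (b z : R) : - b <= z <= b -> clip b z = z.
Proof. by move=> /andP[bz zb]; rewrite /clip min_l// max_r. Qed.

Lemma norm_clip_le (R : realType) (b z : R) : `|clip b z| <= `|b|.
Proof.
rewrite ler_norml /clip le_max lerN2 ler_norm/= ge_max.
by rewrite -normrN ler_norm/= normrN ge_min ler_norm orbT.
Qed.

Lemma measurable_clip (R : realType) (b : R) : measurable_fun [set: R] (clip b).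
Proof. by apply: measurable_maxr => //; exact: measurable_minr. Qed.

(** The integrand of the variational form, clipped so that it is bounded for every [z]. *)
Definition shortfall (R : realType) (b c z : R) : R := Num.min (clip b z - c) 0.

Lemma norm_shortfall_le (R : realType) (b c z : R) :
  `|shortfall b c z| <= `|b| + `|c|.
Proof.
have : `|clip b z - c| <= `|b| + `|c|.
  by rewrite (le_trans (ler_normB _ _))// lerD2r norm_clip_le.
rewrite /shortfall; case: (leP (clip b z - c) 0) => // _ _.
by rewrite normr0 addr_ge0.
Qed.

Lemma measurable_shortfall (R : realType) (b c : R) :
  measurable_fun [set: R] (shortfall b c).
Proof.
apply: measurable_minr => //; apply: measurable_funB => //.
exact: measurable_clip.
Qed.

(** * The variational form of the CVaR *)

Section cvar_variational.
Context (d : measure_display) (T : measurableType d) (R : realType).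
Context (P : probability T R) (X : {RV P >-> R}) (alpha b : R).
Hypothesis alpha01 : 0 < alpha < 1.
Hypothesis cdf_continuous : continuous (cdf X).
Hypothesis X_bounded : {ae P, forall w, - b <= X w <= b}.

Let nu := value_at_risk X alpha.
Let A := [set w | X w <= nu].

Let mX : measurable_fun [set: T] (X : T -> R).
Proof. exact: (measurable_funPT X). Qed.

Lemma measurable_tail : measurable A.
Proof.
have -> : A = X @^-1` `]-oo, nu].
  by apply/seteqP; split => w /=; rewrite in_itv.
exact: measurable_funPTI.
Qed.

Lemma probability_tail : P A = alpha%:E.
Proof.
rewrite -(cdf_value_at_risk alpha01 cdf_continuous) /cdf/= /distribution.
by congr (P _); apply/seteqP; split => w /=; rewrite in_itv.
Qed.

Let mclipX : measurable_fun [set: T] (fun w => clip b (X w)).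
Proof. exact: measurableT_comp (measurable_clip b) mX. Qed.

(** The factor [alpha] cancels the probability of the tail; the clipped integral is finite, so
    [fine] respects the quotient. *)
Lemma cvar_clip :
  alpha * cvar X alpha = \int[P]_(w in A) clip b (X w).
Proof.
have [a0 _] := andP alpha01.
have AE : (\int[P]_(w in A) (X w)%:E = \int[P]_(w in A) (clip b (X w))%:E)%E.
  apply: ae_eq_integral.
  - exact: measurable_tail.
  - exact/measurable_EFinP/measurable_funTS.
  - exact/measurable_EFinP/measurable_funTS.
  - by apply: filterS X_bounded => w Xw _; rewrite clip_id.
have fin : (\int[P]_(w in A) (clip b (X w))%:E)%E \is a fin_num.
  apply: integrable_fin_num; first exact: measurable_tail.
  apply: (@integrable_bounded _ _ _ _ _ _ `|b|) => //.
    exact: measurable_tail.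
  by move=> w; exact: norm_clip_le.
have -> : cvar X alpha = fine (\int[P]_(w in A) (X w)%:E / P A)%E by [].
rewrite probability_tail AE.
rewrite inver gt_eqF// fineM//= /Rintegral mulrCA divff ?mulr1// gt_eqF//.
Qed.

(** Extending the integrand by 0 outside [A] allows a pointwise comparison with [shortfall]. *)
Lemma cvar_sub (c : R) :
  alpha * (cvar X alpha - c) = \int[P]_w ((fun w => clip b (X w) - c) \_ A) w.
Proof.
rewrite -Rintegral_mkcond RintegralB; last first.
- apply: (@integrable_bounded _ _ _ _ _ _ `|c|) => //.
  exact: measurable_tail.
- apply: (@integrable_bounded _ _ _ _ _ _ `|b|) => //.
    exact: measurable_tail.
  by move=> w; exact: norm_clip_le.
- exact: measurable_tail.
rewrite Rintegral_cst; last exact: measurable_tail.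
by rewrite (congr1 fine probability_tail)/= -cvar_clip mulrBr (mulrC c).
Qed.

Let integrable_shortfall (c : R) :
  P.-integrable [set: T] (EFin \o (fun w => shortfall b c (X w))).
Proof.
apply: (@integrable_bounded _ _ _ _ _ _ (`|b| + `|c|)) => //.
  exact: measurableT_comp (measurable_shortfall b c) mX.
by move=> w; exact: norm_shortfall_le.
Qed.

Let mtail (c : R) :
  measurable_fun [set: T] ((fun w => clip b (X w) - c) \_ A).
Proof.
apply/(measurable_restrictT _ measurable_tail).
apply: measurable_funTS; exact: measurable_funB.
Qed.

(** The minimum is at most its first argument, used on [A], and at most 0, used off [A]. *)
Lemma cvar_ge (c : R) :
  c + alpha^-1 * \int[P]_w shortfall b c (X w) <= cvar X alpha.
Proof.
have [a0 _] := andP alpha01.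
rewrite -lerBrDl ler_pdivrMl// cvar_sub.
apply: le_Rintegral => //.
  apply: (@integrable_bounded _ _ _ _ _ _ (`|b| + `|c|)) => // w.
  rewrite /patch; case: ifPn => _; last by rewrite normr0 addr_ge0.
  by rewrite (le_trans (ler_normB _ _))// lerD2r norm_clip_le.
move=> w _; rewrite /patch /shortfall ge_min; case: ifPn => _.
  by rewrite lexx.
by rewrite lexx orbT.
Qed.

(** For [c = nu] the tail [A] is exactly where [X - c <= 0], so the two integrands agree almost
    surely. *)
Lemma cvar_value_at_risk :
  cvar X alpha = nu + alpha^-1 * \int[P]_w shortfall b nu (X w).
Proof.
have [a0 _] := andP alpha01.
apply: (canRL (subrKC _)); apply: (canRL (mulKf _)); first by rewrite gt_eqF.
rewrite cvar_sub /Rintegral; congr fine.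
apply: ae_eq_integral => //.
- exact/measurable_EFinP.
- by have /integrableP[] := integrable_shortfall nu.
apply: filterS X_bounded => w Xw _; congr EFin.
rewrite /patch /shortfall; case: ifPn => [/set_mem|/negP Xnu].
  by rewrite /A/= clip_id// => ?; rewrite min_l// subr_le0.
rewrite clip_id// min_r// subr_ge0 leNgt; apply/negP => /ltW wA.
by apply: Xnu; exact/mem_set.
Qed.

End cvar_variational.

(** * Differentiation under the integral sign *)

(** The derivative is the pointwise limit of the quotients with steps [1 / (n + 1)]. *)
Lemma measurable_derive (d : measure_display) (Y : measurableType d)
    (R : realType) (q : R -> Y -> R) (a : R) :
  (forall t, measurable_fun [set: Y] (q t)) ->
  (forall y, derivable (q ^~ y) a 1) ->
  measurable_fun [set: Y] (fun y => 'D_1 (q ^~ y) a).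
Proof.
move=> mq dq; pose e (n : nat) : R := n.+1%:R^-1.
have e0 : (forall n, e n != 0) /\ e n @[n --> \oo] --> 0.
  split=> [n|]; first by rewrite invr_eq0 pnatr_eq0.
  exact: cvg_harmonic.
apply: (@measurable_fun_cvg _ _ _ _
  (fun n y => (e n)^-1 *: (q (e n + a) y - q a y))).
  move=> n; apply: measurable_funM => //.
  exact: measurable_funB.
move=> y _; have /cvg_ex[l ql] := dq y.
have -> : 'D_1 (q ^~ y) a = l by exact/cvg_lim.
move: ql => /cvgr_dnbhsP/(_ _ e0).
by under eq_fun do rewrite scaler1.
Qed.

Section log_lipschitz_family.
Context (R : realType) (p : R -> R -> R) (M : R).
Hypothesis measurable_p : forall t, measurable_fun [set: R] (p t).
Hypothesis integrable_p :
  forall t, (@lebesgue_measure R).-integrable [set: R] (EFin \o p t).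
Hypothesis p_ge0 : forall t z, 0 <= p t z.
Hypothesis derivable_p : forall z (t : R), derivable (p ^~ z) t 1.
Hypothesis norm_derive_p : forall z t, `|'D_1 (p ^~ z) t| <= M * p t z.

Let integrable_dominated (g : R -> R) (K t : R) : measurable_fun [set: R] g ->
  (forall z, `|g z| <= K * p t z) ->
  (@lebesgue_measure R).-integrable [set: R] (EFin \o g).
Proof.
move=> mg gK.
have intKp : (@lebesgue_measure R).-integrable [set: R]
    (EFin \o (fun z => K * p t z)).
  have := integrableZl measurableT K (integrable_p t).
  by apply: eq_integrable.
apply: le_integrable intKp => //; first exact/measurable_EFinP.
by move=> z _; rewrite lee_fin; exact: le_trans (gK z) (ler_norm _).
Qed.

Variables (h : R -> R) (K : R).
Hypothesis measurable_h : measurable_fun [set: R] h.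
Hypothesis norm_h : forall z, `|h z| <= K.

Let norm_h_derive_p z t : `|h z * 'D_1 (p ^~ z) t| <= K * M * p t z.
Proof. by rewrite normrM -mulrA ler_pM. Qed.

Lemma integrable_h_derive_p (a : R) :
  (@lebesgue_measure R).-integrable [set: R]
    (EFin \o (fun z => h z * 'D_1 (p ^~ z) a)).
Proof.
apply: (@integrable_dominated _ (K * M) a) => //.
by apply: measurable_funM => //; exact: measurable_derive.
Qed.

Let derive_hp z t : 'D_1 (fun s : R => h z * p s z) t = h z * 'D_1 (p ^~ z) t.
Proof. by rewrite deriveZ. Qed.

Lemma is_derive_integral (a : R) :
  is_derive a 1 (fun t : R => \int[lebesgue_measure]_z (h z * p t z))
    (\int[lebesgue_measure]_z (h z * 'D_1 (p ^~ z) a)).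
Proof.
pose hp (t z : R) := h z * p t z.
(* On the interval of radius 1 around [a] the Gronwall factor is at most [expR |M|]; the absolute
   value is taken because [M] has no assumed sign. *)
pose G z := K * `|M| * expR `|M| * p a z.
have K0 : 0 <= K by exact: le_trans (normr_ge0 _) (norm_h 0).
have Ia : a \in `]a - 1, a + 1[ by rewrite in_itv/=; apply/andP; split; lra.
have int_hp x : `]a - 1, a + 1[%classic x ->
    (@lebesgue_measure R).-integrable [set: R] (EFin \o hp x).
  move=> _; apply: (@integrable_dominated _ K x).
    exact: measurable_funM.
  by move=> z; rewrite normrM (ger0_norm (p_ge0 _ _)) ler_wpM2r.
have d_hp x z : `]a - 1, a + 1[%classic x -> [set: R] z ->
    derivable (hp ^~ z) x 1.
  by move=> _ _; exact: derivableZ.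
have G0 z : 0 <= G z by rewrite !mulr_ge0// expR_ge0.
have int_G : (@lebesgue_measure R).-integrable [set: R] (EFin \o G).
  apply: (@integrable_dominated _ (K * `|M| * expR `|M|) a).
    exact: measurable_funM.
  by move=> z; rewrite ger0_norm.
have G_ub x z : `]a - 1, a + 1[%classic x -> [set: R] z ->
    `|partial1of2 hp x z| <= G z.
  rewrite /= in_itv/= => /andP[ax xa] _.
  rewrite partial1of2E derive_hp (le_trans (norm_h_derive_p _ _))//.
  rewrite /G -!mulrA ler_wpM2l//.
  have pxa : p x z <= expR `|M| * p a z.
    rewrite (le_trans (gronwall (@derivable_p z) (norm_derive_p z) a x))//.
    rewrite ler_wpM2r// ler_expR.
    have xa1 : `|x - a| <= 1 by rewrite ler_norml; apply/andP; split; lra.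
    rewrite (le_trans (ler_norm _))// normrM normr_id.
    by rewrite ler_piMr.
  by rewrite (le_trans (ler_wpM2r (p_ge0 x z) (ler_norm M)))// ler_wpM2l.
have dF := derivable_under_integral measurableT Ia int_hp d_hp G0 int_G G_ub.
apply: DeriveDef => //.
rewrite -derive1E.
rewrite (differentiation_under_integral measurableT Ia int_hp d_hp G0 int_G
  G_ub).
by apply: eq_Rintegral => z _; rewrite partial1of2E derive_hp.
Qed.

Lemma is_derive_ln_family z (a : R) :
  is_derive a 1 (fun t : R => ln (p t z)) ('D_1 (p ^~ z) a / p a z).
Proof.
have [pa0|pa0] := eqVneq (p a z) 0.
  (* A zero of the density persists along the line, so both sides are junk
     values equal to 0. *)
  have p0 t : p t z = 0.
    apply/eqP; rewrite eq_le p_ge0 andbT.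
    by have := gronwall (@derivable_p z) (norm_derive_p z) a t;
      rewrite pa0 mulr0.
  have -> : (fun t : R => ln (p t z)) = cst (ln 0).
    by apply/funext => t; rewrite p0.
  by rewrite pa0 invr0 mulr0; exact: is_derive_cst.
have pa : 0 < p a z by rewrite lt_neqAle eq_sym pa0 p_ge0.
have dp : is_derive a 1 (p ^~ z) ('D_1 (p ^~ z) a) by exact: DeriveDef.
have dln := is_derive1_ln pa.
by apply: is_derive_eq (is_derive1_comp dln dp) _; rewrite mulrC.
Qed.

End log_lipschitz_family.

(** * The gradient formula *)

(* The parameter acts on the law: [P theta] is the probability measure with
   parameter theta, and [f z theta] is f_Z(z; theta). *)
Theorem proposition1 (R : realType) (d : measure_display) (T : measurableType d)
    (k : nat) (P : 'rV[R]_k -> probability T R) (Z : {mfun T >-> R})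
    (f : R -> 'rV[R]_k -> R) (alpha b : R)
    (nu := fun theta => @value_at_risk d T R (P theta) Z alpha)
    (Phi := fun theta => @cvar d T R (P theta) Z alpha)
    (halpha : 0 < alpha < 1)
    (hdensity : forall theta,
       @is_density d T R (P theta) Z (fun z => f z theta))
    (hcontinuous : forall theta, continuous (@cdf d T R (P theta) Z))
    (hbounded : forall theta, {ae P theta, forall w, - b <= Z w <= b})
    (hnu_derivable : forall theta j, derivable nu theta (basis_vec j))
    (hnu_bounded : exists M : R, forall theta j,
       `| 'D_(basis_vec j) nu theta | <= M)
    (hPhi_derivable : forall theta j, derivable Phi theta (basis_vec j))
    (hPhi_bounded : exists M : R, forall theta j,
       `| 'D_(basis_vec j) Phi theta | <= M)
    (* Outside the support f = 0, hence the derivative vanishes there (f >= 0),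
       and the ratio is 0 / 0, which evaluates to 0. *)
    (hf_derivable : forall theta z j, derivable (f z) theta (basis_vec j))
    (hf_ratio_bounded : exists M : R, forall theta z j,
       `| 'D_(basis_vec j) (f z) theta / f z theta | <= M) :
  forall theta (j : 'I_k),
    ('D_(basis_vec j) Phi theta)%:E =
    cond_expectation (P theta) [set w | Z w <= nu theta]
      (fun w => 'D_(basis_vec j) (fun t => ln (f (Z w) t)) theta
                * (Z w - nu theta)).
Proof.
move=> theta j; set v := basis_vec j; set c := nu theta.
have [M ratioM] := hf_ratio_bounded.
have [a0 _] := andP halpha.
pose p (t z : R) := f z (theta + t *: v).
have theta0 : theta = theta + (0 : R) *: v by rewrite scale0r addr0.
have p_ge0 t z : 0 <= p t z by have [_ + _] := hdensity (theta + t *: v); exact.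
have mp t : measurable_fun [set: R] (p t).
  by have [] := hdensity (theta + t *: v).
have dp z (t : R) : derivable (p ^~ z) t 1.
  by apply: (@derivable_line _ _ (f z)); exact: hf_derivable.
have int_p t : (@lebesgue_measure R).-integrable [set: R] (EFin \o p t).
  apply/integrableP; split; first by apply/measurable_EFinP; exact: mp.
  under eq_integral do rewrite gee0_abs ?lee_fin//.
  have [_ _ <-//] := hdensity (theta + t *: v).
  exact: le_lt_trans (probability_le1 _ _) (ltry _).
(* The ratio bound is cleared of its denominator; at a zero of the density both sides are 0. *)
have ndp z (t : R) : `|'D_1 (p ^~ z) t| <= M * p t z.
  have [pt0|pt0] := eqVneq (p t z) 0.
    by rewrite (derive_zero_at_zero (dp z) (p_ge0 ^~ z) pt0) pt0 normr0 mulr0.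
  have pt : 0 < p t z by rewrite lt_neqAle eq_sym pt0 p_ge0.
  rewrite -ler_pdivrMr// -(gtr0_norm pt) -normf_div.
  rewrite (@derive_line _ _ (f z)); exact: ratioM.
pose h := shortfall b c.
have mh : measurable_fun [set: R] h := measurable_shortfall b c.
have nh z : `|h z| <= `|b| + `|c| := norm_shortfall_le b c z.
pose F (t : R) := \int[lebesgue_measure]_z (h z * p t z).
have dF (t : R) : is_derive t 1 F
    (\int[lebesgue_measure]_z (h z * 'D_1 (p ^~ z) t)).
  exact: (is_derive_integral mp int_p p_ge0 dp ndp mh nh).
have FE t : \int[P (theta + t *: v)]_w h (Z w) = F t.
  by congr fine; apply: integral_density.
have dPhi (t : R) : is_derive t 1 (fun s : R => Phi (theta + s *: v))
    ('D_v Phi (theta + t *: v)).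
  apply: DeriveDef; last exact: derive_line.
  by apply: derivable_line; exact: hPhi_derivable.
pose gap (t : R) := Phi (theta + t *: v) - (c + alpha^-1 * F t).
have dgap (t : R) : is_derive t 1 gap ('D_v Phi (theta + t *: v) -
    alpha^-1 * \int[lebesgue_measure]_z (h z * 'D_1 (p ^~ z) t)).
  have -> : gap =
      (fun s : R => Phi (theta + s *: v)) - (cst c + alpha^-1 *: F).
    by apply/funext.
  have dc : is_derive t 1 (cst c : R -> R) 0 := is_derive_cst c t 1.
  apply: is_derive_eq
    (is_deriveB (dPhi t) (is_deriveD dc (is_deriveZ _ (dF t)))) _.
  by rewrite add0r.
(* The variational inequality holds for every law on the line with the same frozen [c]. *)
have gap_ge0 t : 0 <= gap t.
  by rewrite subr_ge0 -FE; exact: cvar_ge.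
have gap0 : gap 0 = 0.
  apply/eqP; rewrite subr_eq0 -FE -theta0; apply/eqP.
  exact: cvar_value_at_risk.
have : 'D_1 gap 0 = 0.
  by apply: derive_zero_at_zero gap0 => // t; exact: ex_derive.
rewrite derive_val -theta0 => /subr0_eq ->.
(* The score function; what remains is to turn the derivative of [p] into score times density. *)
pose s z := 'D_v (fun t => ln (f z t)) theta.
have sE z : s z = 'D_1 (fun t : R => ln (p t z)) 0.
  by rewrite /p (@derive_line _ _ (fun x => ln (f z x))) -theta0.
have dln z := is_derive_ln_family p_ge0 dp ndp z 0.
have ms : measurable_fun [set: R] s.
  have -> : s = fun z => 'D_1 (fun t : R => ln (p t z)) 0 by exact/funext.
  apply: (@measurable_derive _ _ R (fun t z => ln (p t z))) => [t|z].
    exact: measurableT_comp.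
  exact: ex_derive.
have spE z : s z * p 0 z = 'D_1 (p ^~ z) 0.
  rewrite sE derive_val; have [pz0|pz0] := eqVneq (p 0 z) 0.
    by rewrite pz0 mulr0 (derive_zero_at_zero (dp z) (p_ge0 ^~ z) pz0).
  by rewrite divfK.
pose A := [set w | Z w <= c].
have mA : measurable A by exact: measurable_tail.
have mZ : measurable_fun [set: T] (Z : T -> R) := measurable_funPT Z.
have PA : P theta A = alpha%:E by exact: probability_tail.
(* Almost surely [h (Z w)] is [Z w - c] on the tail and 0 off it. *)
have tailE : (\int[P theta]_(w in A) (s (Z w) * (Z w - c))%:E =
    \int[P theta]_w (s (Z w) * h (Z w))%:E)%E.
  rewrite integral_mkcond; apply: ae_eq_integral => //.
  - apply/(measurable_restrictT _ mA)/measurable_EFinP/measurable_funTS.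
    apply: measurable_funM; first exact: measurableT_comp.
    exact: measurable_funB.
  - apply/measurable_EFinP/measurable_funM; exact: measurableT_comp.
  apply: filterS (hbounded theta) => w Zw _.
  rewrite /patch /h /shortfall clip_id//.
  case: ifPn => [/set_mem/= Zc|/negP Zc].
    by rewrite min_l// subr_le0.
  rewrite min_r ?mulr0// subr_ge0 leNgt; apply/negP => /ltW Zc'.
  by apply: Zc; exact/mem_set.
have intE : (\int[P theta]_w (s (Z w) * h (Z w))%:E =
    (\int[lebesgue_measure]_z (h z * 'D_1 (p ^~ z) 0))%:E)%E.
  rewrite (@integral_density _ _ _ _ _ (p 0) (fun z => s z * h z)); last 2 first.
  - by have := hdensity theta; rewrite {2}theta0.
  - exact: measurable_funM.
  rewrite fineK; last first.
    apply: integrable_fin_num => //.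
    exact: (integrable_h_derive_p mp int_p dp ndp mh nh).
  by apply: eq_integral => z _; rewrite -spE mulrCA mulrA.
rewrite /cond_expectation.
transitivity ((\int[P theta]_(w in A) (s (Z w) * (Z w - c))%:E)
  / alpha%:E)%E; last by rewrite -PA.
by rewrite tailE intE inver gt_eqF// -EFinM mulrC.
Qed.
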